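(* Let $1\le k\le d$ and $\epsilon\in(0,1)$. There exist a distribution over linear sketching matrices $S$ with $O(k\log(k/\epsilon)/\epsilon^2+k\log(d)/\epsilon)$ rows (measurements), not depending on the input, and a recovery procedure such that for every $x\in\mathbb{R}^d$, given $Sx$, with probability at least $1-1/\mathrm{poly}(d)-1/\mathrm{poly}(k/\epsilon)$ it returns $\hat x\in\Psi_k$ satisfying $$\|x-\hat x\|_2^2\le(1+\epsilon)\min_{x_k\in\Psi_k}\|x-x_k\|_2^2.$$
   Context: $\Psi_k=\{x\in\mathbb{R}^d:\|x\|_0\le k\}$. *)

(* Defs.v *)
From HB Require Import structures.
From mathcomp Require Import all_boot all_order all_algebra.
From mathcomp Require Import all_classical all_reals all_analysis.
Set Implicit Arguments.
Unset Strict Implicit.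
Unset Printing Implicit Defensive.
Import Order.TTheory GRing.Theory Num.Theory.
Local Open Scope classical_set_scope.
Local Open Scope ring_scope.

(* The norm `|x| that MathComp-Analysis puts on matrices is the sup norm, hence
   a separate Euclidean norm. *)
Definition l2norm (R : realType) (d : nat) (x : 'cV[R]_d) : R :=
  Num.sqrt (\sum_(i < d) x i 0 ^+ 2).

Definition l0norm (R : realType) (d : nat) (x : 'cV[R]_d) : nat :=
  #|[pred i : 'I_d | x i 0 != 0]|.

Definition Psi (R : realType) (d k : nat) : set 'cV[R]_d :=
  [set x | (l0norm x <= k)%N].
Arguments Psi : clear implicits.

(* min_{y in Psi_k} ||x - y||_2^2.  It is written as an infimum; the infimum is
   attained, see best_sq_err_attained. *)
Definition best_sq_err (R : realType) (d k : nat) (x : 'cV[R]_d) : R :=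
  inf [set l2norm (x - y) ^+ 2 | y in Psi R d k].

(* No sigma-algebra on 'M[R]_(m, d) is provided by the library; measurability
   for the Borel sigma-algebra of R^(m x d) is measurability of every entry. *)
Definition random_matrix (R : realType) (m d : nat) (disp : measure_display)
    (Omega : measurableType disp) (S : Omega -> 'M[R]_(m, d)) : Prop :=
  forall (i : 'I_m) (j : 'I_d),
    measurable_fun [set: Omega] (fun w => S w i j).

(* The recovery procedure: a deterministic function of the (drawn, hence known)
   sketching matrix S and of the measurements S x. *)
Definition recovery (R : realType) (m d : nat) : Type :=
  'M[R]_(m, d) -> 'cV[R]_m -> 'cV[R]_d.

Definition recovers (R : realType) (m d k : nat) (eps : R)
    (rec : recovery R m d) (S : 'M[R]_(m, d)) (x : 'cV[R]_d) : Prop :=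
  let xhat := rec S (S *m x) in
  Psi R d k xhat /\ l2norm (x - xhat) ^+ 2 <= (1 + eps) * best_sq_err k x.

Lemma l2norm_sq (R : realType) (d : nat) (x : 'cV[R]_d) :
  l2norm x ^+ 2 = \sum_(i < d) x i 0 ^+ 2.
Proof. by rewrite sqr_sqrtr // sumr_ge0 // => i _; rewrite sqr_ge0. Qed.

Lemma best_sq_err_attained (R : realType) (d k : nat) (x : 'cV[R]_d) :
  exists2 y, Psi R d k y & best_sq_err k x = l2norm (x - y) ^+ 2 /\
    (forall z, Psi R d k z -> l2norm (x - y) ^+ 2 <= l2norm (x - z) ^+ 2).
Proof.
pose res (A : {set 'I_d}) : 'cV[R]_d := \col_i (if i \in A then x i 0 else 0).
pose f (A : {set 'I_d}) := l2norm (x - res A) ^+ 2.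
have res_le (A : {set 'I_d}) : (l0norm (res A) <= #|A|)%N.
  apply/subset_leq_card/fintype.subsetP => i; rewrite !inE mxE.
  by case: ifP => //; rewrite eqxx.
have P0 : (#|(finset.set0 : {set 'I_d})| <= k)%N by rewrite cards0.
case: (@Order.TotalTheory.arg_minP _ R _ finset.set0 (fun A : {set 'I_d} => #|A| <= k)%N f P0) => A Ak minA.
have resP : Psi R d k (res A) by exact: leq_trans (res_le A) Ak.
have minres z : Psi R d k z -> l2norm (x - res A) ^+ 2 <= l2norm (x - z) ^+ 2.
  move=> zk; pose B : {set 'I_d} := finset (fun i => z i 0 != 0).
  have Bk : (#|B| <= k)%N.
    by apply: leq_trans zk; apply/subset_leq_card/fintype.subsetP => i; rewrite !inE.
  apply: (le_trans (minA B Bk)); rewrite /f !l2norm_sq; apply: ler_sum => i _.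
  rewrite !mxE finset.inE; case: eqP => [->|_] //=.
  by rewrite subrr expr0n sqr_ge0.
exists (res A) => //; split => //.
apply/eqP; rewrite eq_le; apply/andP; split.
- apply: ge_inf; last by exists (res A).
  by exists 0 => _ [y _ <-]; rewrite sqr_ge0.
- apply: lb_le_inf; first by exists (l2norm (x - res A) ^+ 2), (res A).
  by move=> _ [y yk <-]; exact: minres.
Qed.

(* Main.v *)
Require Import Defs.
From HB Require Import structures.
From mathcomp Require Import all_boot all_order all_algebra.
From mathcomp Require Import ring lra zify.
Set Implicit Arguments.
Unset Strict Implicit.
Unset Printing Implicit Defensive.
Import Order.TTheory GRing.Theory Num.Theory.
Local Open Scope ring_scope.

(* Fix an integer n with 1/eps < n <= 2/eps and let E^2 be the squared error of
   the best k-sparse approximation of x.  The sketch stacks two independent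
   CountSketches, each estimating a coordinate by the median over its
   repetitions; a single
   repetition is off by more than 16 E^2 / (number of buckets) with probability
   at most 1/8, hence the median over 2t repetitions with probability at most
   2^-t.
   A coarse sketch (O(kn) buckets, O(log d) repetitions) is accurate at all d
   coordinates and selects the set L of the O(kn) largest estimates, outside of
   which the best support loses only O(eps) E^2.  A fine sketch (O(kn^2) buckets,
   O(log(kn)) repetitions) then needs to be accurate only on L, which does not
   depend on its randomness; the k largest fine estimates in L are returned.
   The randomness is uniform on a finite set of seeds, so probabilities are
   cardinalities and measurability is trivial. *)

(** * One repetition of CountSketch *)

Section CountSketch.
Variables (R : realFieldType) (d B : nat).

(* A seed sends a coordinate to its bucket and its sign (true meaning -1). *)
Local Notation hash := {ffun 'I_d -> 'I_B.+1 * bool}.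

Definition hash_entry (w : hash) (b : 'I_B.+1) (j : 'I_d) : R :=
  if (w j).1 == b then (-1) ^+ (w j).2 else 0.

(** Multiplication by the transpose of [M]. Since [M] is arbitrary, a decoder can apply it to a
    sketch without access to the seed. *)
Definition backproject (M : 'I_B.+1 -> 'I_d -> R) (y : 'I_B.+1 -> R) (i : 'I_d) : R :=
  \sum_b M b i * y b.

Definition estimate (x : 'I_d -> R) (w : hash) (i : 'I_d) : R :=
  backproject (hash_entry w) (fun b => \sum_j hash_entry w b j * x j) i.

(** The sign of [i] is left out: it does not affect the square, which is all that gets bounded. *)
Definition noise (x : 'I_d -> R) (J : {set 'I_d}) (i : 'I_d) (w : hash) : R :=
  \sum_(j in J) ((w j).1 == (w i).1)%:R * (-1) ^+ (w j).2 * x j.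

Definition collision (i j : 'I_d) : {set hash} :=
  [set w : hash | (w j).1 == (w i).1].

(** Addition in ['I_B.+1] is modulo [B.+1], so the shift permutes the seeds. *)
Definition shift_bucket (j : 'I_d) (b : 'I_B.+1) (w : hash) : hash :=
  [ffun l => if l == j then ((w l).1 + b, (w l).2) else w l].

Definition flip_sign (j : 'I_d) (w : hash) : hash :=
  [ffun l => if l == j then ((w l).1, ~~ (w l).2) else w l].

Lemma shift_bucketK (j : 'I_d) (b : 'I_B.+1) :
  cancel (shift_bucket j b) (shift_bucket j (- b)).
Proof.
move=> w; apply/ffunP => l; rewrite !ffunE; case: ifP => //= -> //=.
by rewrite addrK; case: (w l).
Qed.

Lemma flip_signK (j : 'I_d) : involutive (flip_sign j).
Proof.
move=> w; apply/ffunP => l; rewrite !ffunE; case: ifP => //= -> //=.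
by rewrite negbK; case: (w l).
Qed.

(* Shifting the bucket of [j] by each [b] in turn permutes the seeds, and for
   each seed exactly one [b] produces the collision. *)
Lemma card_collision (i j : 'I_d) : j != i ->
  (B.+1 * #|collision i j|)%N = #|{: hash}|.
Proof.
move=> ji.
have shift b : #|collision i j| = (\sum_(w : hash) (((w j).1 + b)%R == (w i).1))%N.
  rewrite -sum1_card big_mkcond /=.
  rewrite (reindex_inj (can_inj (shift_bucketK j b))) /=.
  apply: eq_bigr => w _; rewrite inE !ffunE eqxx [i == j]eq_sym (negPf ji) /=.
  by case: eqP.
have -> : (B.+1 * #|collision i j| =
    \sum_(b : 'I_B.+1) \sum_(w : hash) (((w j).1 + b)%R == (w i).1))%N.
  by under eq_bigr => b _ do rewrite -shift; rewrite sum_nat_const card_ord.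
rewrite exchange_big /= -sum1_card; apply: eq_bigr => w _.
rewrite (bigD1 ((w i).1 - (w j).1)) //= addrC subrK eqxx big1 // => b /negPf bE.
by rewrite addrC -[(w i).1](subrK (w j).1) (inj_eq (addIr _)) bE.
Qed.

(* Flipping the sign of one coordinate kills the cross terms. *)
Lemma noise_second_moment (x : 'I_d -> R) (J : {set 'I_d}) (i : 'I_d) :
  i \notin J ->
  \sum_w noise x J i w ^+ 2 = \sum_(j in J) x j ^+ 2 * #|collision i j|%:R.
Proof.
move=> iJ; pose c (w : hash) j : R := ((w j).1 == (w i).1)%:R * (-1) ^+ (w j).2.
have -> : \sum_w noise x J i w ^+ 2 =
    \sum_(j in J) \sum_(l in J) x j * x l * \sum_w c w j * c w l.
  rewrite (eq_bigr (fun w => \sum_(j in J) \sum_(l in J) x j * x l * (c w j * c w l))).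
    rewrite exchange_big /=; apply: eq_bigr => j _.
    by rewrite exchange_big /=; apply: eq_bigr => l _; rewrite mulr_sumr.
  move=> w _; rewrite expr2 /noise big_distrl /=; apply: eq_bigr => j _.
  rewrite big_distrr /=; apply: eq_bigr => l _; rewrite /c; ring.
apply: eq_bigr => j jJ; rewrite (bigD1 j) //= [X in _ + X]big1 ?addr0.
  rewrite -expr2; congr (_ * _); rewrite -sum1_card natr_sum [RHS]big_mkcond /=.
  apply: eq_bigr => w _; rewrite inE /c mulrACA -expr2 -signr_addb addbb expr0.
  by rewrite mulr1; case: eqP => _; rewrite ?expr1n ?expr0n //= mulr0n.
move=> l /andP[_ lj]; apply/eqP; rewrite mulf_eq0; apply/orP; right.
have ij : (i == j) = false by apply: contraNF iJ => /eqP ->.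
set s := \sum_w _; suff sN : s = - s by apply/eqP; lra.
rewrite {1}/s (reindex_inj (inv_inj (flip_signK j))) /= -sumrN.
apply: eq_bigr => w _; rewrite /c !ffunE eqxx ij (negPf lj) /= signrN.
ring.
Qed.

Lemma estimate_noise (x : 'I_d -> R) (w : hash) (i : 'I_d) :
  estimate x w i - x i = (-1) ^+ (w i).2 * noise x (~: [set i]) i w.
Proof.
have -> : estimate x w i =
    \sum_j ((w j).1 == (w i).1)%:R * (-1) ^+ (w i).2 * (-1) ^+ (w j).2 * x j.
  rewrite /estimate /backproject; under eq_bigr => b _ do rewrite mulr_sumr.
  rewrite exchange_big /=; apply: eq_bigr => j _.
  rewrite (bigD1 (w i).1) //= big1 ?addr0 /hash_entry ?eqxx.
    by case: eqP => _ /=; ring.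
  by move=> b /negPf; rewrite eq_sym => ->; rewrite mul0r.
rewrite (bigD1 i) //= eqxx -!mulrA [(-1) ^+ _ * _]mulrA -signr_addb addbb.
rewrite /= expr0 !mul1r [LHS]addrC addKr /noise mulr_sumr; apply: eq_big => j.
  by rewrite !inE.
by move=> _; ring.
Qed.

(** Markov's inequality: by [card_collision] the mean of the squared noise is at most the tail
    outside [T] divided by [B.+1], and the threshold is 16 times that. *)
Lemma card_noise_gt (x : 'I_d -> R) (J T : {set 'I_d}) (i : 'I_d) :
  i \notin J -> J \subset ~: T ->
  (16 * #|[set w | 16 / B.+1%:R * (\sum_(j in ~: T) x j ^+ 2)
                   < noise x J i w ^+ 2]%R| <= #|{: hash}|)%N.
Proof.
move=> iJ JT; set tail := \sum_(j in _) _; set bad := [set w | _].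
have tailJ : \sum_(j in J) x j ^+ 2 <= tail.
  rewrite /tail [leRHS](big_setID J) /= (setIidPr JT) lerDl.
  by apply: sumr_ge0 => j _; rewrite sqr_ge0.
have B0 : (B.+1%:R : R) > 0 by rewrite ltr0n.
have mom : \sum_w noise x J i w ^+ 2 <= #|{: hash}|%:R / B.+1%:R * tail.
  rewrite noise_second_moment // (eq_bigr (fun j => #|{: hash}|%:R / B.+1%:R * x j ^+ 2)).
    by rewrite -mulr_sumr ler_wpM2l // divr_ge0.
  move=> j jJ; rewrite -(@card_collision i j); last by apply: contraNneq iJ => <-.
  by rewrite natrM [B.+1%:R * _]mulrC mulfK ?gt_eqF // mulrC.
have markov : #|bad|%:R * (16 / B.+1%:R * tail) <= \sum_w noise x J i w ^+ 2.
  rewrite -sum1_card natr_sum mulr_suml [leLHS]big_mkcond /=; apply: ler_sum => w _.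
  by case: ifP => [|_]; rewrite ?sqr_ge0 // inE mul1r => /ltW.
have [tail0|tail0] := ltrP 0 tail.
  rewrite -(ler_nat R) natrM -(ler_pM2r tail0) -(ler_pM2r (_ : 0 < B.+1%:R^-1 :> R)) ?invr_gt0 //.
  have := le_trans markov mom; congr (_ <= _); ring.
(* With a zero tail Markov's inequality is void, but the second moment is then zero, so the noise
   vanishes for every seed. *)
suff -> : bad = set0 by rewrite cards0 muln0.
have tailE : tail = 0.
  by apply/eqP; rewrite eq_le tail0 sumr_ge0 // => j _; rewrite sqr_ge0.
apply/setP => w; rewrite !inE tailE mulr0; apply/negbTE; rewrite -leNgt.
apply: le_trans (_ : \sum_w noise x J i w ^+ 2 <= 0); last first.
  by rewrite (le_trans mom) // tailE mulr0.
by rewrite (bigD1 w) //= lerDl; apply: sumr_ge0 => v _; rewrite sqr_ge0.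
Qed.

(** The budget 1/8 is split evenly between a collision of [i] with [T] (union bound) and large noise
    from outside [T]. Since [i] may itself lie in [T], collisions range over [T :\ i]. *)
Lemma card_estimate_far (x : 'I_d -> R) (T : {set 'I_d}) (i : 'I_d) :
  (16 * #|T| <= B.+1)%N ->
  (8 * #|[set w | 16 / B.+1%:R * (\sum_(j in ~: T) x j ^+ 2)
                  < (estimate x w i - x i) ^+ 2]%R| <= #|{: hash}|)%N.
Proof.
move=> TB; pose J := ~: (T :|: [set i]).
have iJ : i \notin J by rewrite !inE eqxx orbT.
have JT : J \subset ~: T by rewrite setCS subsetUl.
have := card_noise_gt x iJ JT; set bad := finset _; set far := finset _ => cbad.
have sub : far \subset (\bigcup_(j in T :\ i) collision i j) :|: bad.
  apply/subsetP => w; rewrite !inE => wfar; apply/orP.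
  have [/existsP[j /andP[jT ij]]|nocol] :=
      boolP [exists j, (j \in T :\ i) && (w \in collision i j)].
    by left; apply/bigcupP; exists j.
  (* Without such a collision the terms of [T] vanish, so the error is, up to sign, the noise of
     [J]. *)
  right; congr (_ < _): wfar; rewrite estimate_noise exprMn -exprM muln2.
  rewrite -signr_odd odd_double mul1r; congr (_ ^+ 2).
  rewrite /noise [LHS](bigID (mem T)) /= big1 ?add0r.
    by apply: eq_bigl => j; rewrite !inE negb_or andbC.
  move=> j /andP[ji jT]; move: nocol; rewrite negb_exists => /forallP/(_ j).
  rewrite !inE jT andbT in ji *; rewrite ji /= => /negPf ->.
  by rewrite !mul0r.
have cT : (16 * #|\bigcup_(j in T :\ i) collision i j| <= #|{: hash}|)%N.
  rewrite -(leq_pmul2l (_ : 0 < B.+1)%N) //.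
  have cU : (#|\bigcup_(j in T :\ i) collision i j| <=
             \sum_(j in T :\ i) #|collision i j|)%N.
    elim/big_rec2: _ => [|j n A _ An]; first by rewrite cards0.
    by rewrite (leq_trans (leq_card_setU _ _)) // leq_add2l.
  have sE : (B.+1 * \sum_(j in T :\ i) #|collision i j| =
             #|T :\ i| * #|{: hash}|)%N.
    rewrite big_distrr /= -sum_nat_const; apply: eq_bigr => j.
    by rewrite !inE => /andP[ji _]; rewrite card_collision.
  have Ti : (#|T :\ i| <= #|T|)%N by rewrite subset_leq_card // subsetDl.
  rewrite mulnCA; apply: leq_trans (_ : 16 * (#|T :\ i| * #|{: hash}|) <= _)%N.
    by rewrite leq_pmul2l // -sE leq_pmul2l.
  by rewrite mulnA leq_mul2r (leq_trans _ TB) ?orbT // leq_pmul2l.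
have := leq_trans (subset_leq_card sub) (leq_card_setU _ _).
move: cbad cT; move: #|bad| #|far| #|\bigcup_(_ in _) _| #|{: hash}| => *; lia.
Qed.

End CountSketch.

(** * Selection and medians *)

Section Top.
Variables (R : realFieldType) (I : finType).

(** Induction on [K], adding a maximizer of [f] outside [A] each time. The last clause allows [K] to
    exceed the size of [I]; [A] is then everything. *)
Lemma top_set_exists (f : I -> R) (K : nat) :
  exists A : {set I}, (#|A| <= K)%N /\
    (forall i j, i \in A -> j \notin A -> f j <= f i) /\
    (forall j, j \notin A -> #|A| = K).
Proof.
elim: K => [|K [A [AK [Atop Afull]]]].
  by exists set0; rewrite cards0; split=> //; split=> // i j; rewrite inE.
have [/existsP[j0 j0A]|noj] := boolP [exists j, j \notin A]; last first.
  exists A; split; first exact: leqW.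
  split=> // j jA; case/negP: noj; apply/existsP; by exists j.
case: (@Order.TotalTheory.arg_maxP _ _ _ j0 (fun j => j \notin A) f j0A) => j jA jmax.
exists (j |: A); rewrite cardsU1 jA add1n (Afull _ jA); split=> //; split=> //.
move=> i l; rewrite !inE negb_or => /orP[/eqP ->|iA] /andP[_ lA].
  exact: jmax.
exact: Atop.
Qed.

(** For nonnegative [f] this picks [k] largest values in [L]; sums are the form in which the
    exchange argument of [selection_error] uses it. *)
Lemma max_sum_subset_exists (f : I -> R) (L : {set I}) (k : nat) :
  exists U : {set I}, [/\ U \subset L, (#|U| <= k)%N &
    forall A : {set I}, A \subset L -> (#|A| <= k)%N ->
      \sum_(i in A) f i <= \sum_(i in U) f i].
Proof.
pose P (A : {set I}) := (A \subset L) && (#|A| <= k)%N.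
have P0 : P set0 by rewrite /P sub0set cards0.
case: (@Order.TotalTheory.arg_maxP _ R _ set0 P (fun A : {set I} => \sum_(i in A) f i) P0).
move=> U /andP[UL Uk] Umax; exists U; split=> // A AL Ak.
by apply: Umax; rewrite /P AL.
Qed.

End Top.

Section Median.
Variables (R : realFieldType) (t : nat).

(** The number of values being even, every point between the two middle ones qualifies, so [v] need
    not be unique. *)
Definition is_median (e : 'I_(t.*2) -> R) (v : R) : Prop :=
  (#|[set r | (e r < v)%R]| <= t)%N /\ (#|[set r | (v < e r)%R]| <= t)%N.

Lemma median_exists (e : 'I_(t.*2) -> R) : exists v, is_median e v.
Proof.
have [A [At [Atop Afull]]] := top_set_exists e t.
have cA : (#|A| + #|~: A| = t.*2)%N by rewrite cardsC card_ord.
have [/existsP[r0 r0A]|noj] := boolP [exists r, r \notin A].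
  (* The largest value outside the top [t] is a median. *)
  case: (@Order.TotalTheory.arg_maxP _ _ _ r0 (fun r => r \notin A) e r0A) => r rA rmax.
  exists (e r); split; last first.
    apply: leq_trans At; apply/subset_leq_card/subsetP => s; rewrite inE => rs.
    by apply: contraLR rs => sA; rewrite -leNgt; exact: rmax.
  rewrite (leq_trans (_ : _ <= #|~: A|)%N) //; last first.
    by have := Afull _ r0A; lia.
  apply/subset_leq_card/subsetP => s; rewrite !inE => sr.
  by apply: contraL sr => sA; rewrite -leNgt; exact: Atop.
(* Here [A], of size at most [t], contains all [t.*2] indices; so [t = 0] and any value is a
   median. *)
have C0 : #|~: A| = 0%N.
  apply/eqP; rewrite cards_eq0; apply/eqP/setP => r; rewrite !inE.
  by apply: contraNF noj => rA; apply/existsP; exists r.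
have t0 : t = 0%N by lia.
exists 0; rewrite /is_median; split;
  by rewrite (leq_trans (max_card _)) // card_ord t0.
Qed.

(** If [v] were far, more than [t] values would be strictly closer to [y] than [v] is, hence all
    strictly on one side of [v], which a median forbids. *)
Lemma median_near (e : 'I_(t.*2) -> R) (v y b : R) :
  is_median e v -> (#|[set r | b < (e r - y) ^+ 2]%R| < t)%N -> (v - y) ^+ 2 <= b.
Proof.
move=> [vlo vhi] few; rewrite leNgt; apply/negP => far.
pose bad := [set r | b < (e r - y) ^+ 2]%R.
have cb : (#|bad| + #|~: bad| = t.*2)%N by rewrite cardsC card_ord.
have good r : r \in ~: bad -> (e r - y) ^+ 2 < (v - y) ^+ 2.
  by rewrite !inE -leNgt => /le_lt_trans; apply.
have [yv|vy] := leP y v.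
- suff : (#|~: bad| <= #|[set r | (e r < v)%R]|)%N by rewrite -/bad in few; lia.
  apply/subset_leq_card/subsetP => r /good; rewrite inE => rv.
  by rewrite ltNge; apply/negP => ?; nra.
- suff : (#|~: bad| <= #|[set r | (v < e r)%R]|)%N by rewrite -/bad in few; lia.
  apply/subset_leq_card/subsetP => r /good; rewrite inE => rv.
  by rewrite ltNge; apply/negP => ?; nra.
Qed.

End Median.

(* Markov's inequality for the product over the repetitions of the weight that
   is 8 on bad seeds and 1 elsewhere. *)
Lemma card_majority_bad (W : finType) (t : nat) (bad : {set W}) :
  (8 * #|bad| <= #|W|)%N ->
  (#|[set o : {ffun 'I_(t.*2) -> W} | t <= #|[set r | o r \in bad]|]| * 2 ^ t
     <= #|{ffun 'I_(t.*2) -> W}|)%N.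
Proof.
move=> b8; pose F (w : W) := (if w \in bad then 8 else 1)%N.
set M := [set o | _].
have sF : (\sum_w F w <= 2 * #|W|)%N.
  rewrite (bigID (mem bad)) /= (eq_bigr (fun=> 8%N)); last by rewrite /F => w ->.
  rewrite sum_nat_const [X in (_ + X)%N](eq_bigr (fun=> 1%N)); last first.
    by rewrite /F => w /negPf ->.
  rewrite sum1_card.
  have : (#|bad| + #|[predC bad]| <= #|W|)%N by rewrite cardC.
  rewrite mulnC -[#|[predC bad]|]/#|(fun i : W => i \notin bad)|; move: b8.
  by move: #|bad| #|_| #|W| => *; lia.
have markov : (#|M| * 8 ^ t <= \sum_(o : {ffun 'I_(t.*2) -> W}) \prod_r F (o r))%N.
  rewrite mulnC [X in (_ <= X)%N](bigID (mem M)) /=.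
  apply: leq_trans (leq_addr _ _); rewrite mulnC -sum_nat_const; apply: leq_sum => o.
  rewrite inE => ot; rewrite (bigID (fun r => o r \in bad)) /=.
  rewrite (eq_bigr (fun=> 8%N)); last by rewrite /F => r ->.
  rewrite [X in (_ * X)%N]big1; last by rewrite /F => r /negPf ->.
  rewrite muln1 prod_nat_const; apply: leq_pexp2l => //.
  by rewrite (leq_trans ot) // subset_leq_card //; apply/subsetP => r; rewrite inE.
have prodE : (\sum_(o : {ffun 'I_(t.*2) -> W}) \prod_r F (o r) =
              (\sum_w F w) ^ t.*2)%N.
  by rewrite -(bigA_distr_bigA (fun _ w => F w)) /= prod_nat_const card_ord.
(* The mean weight is below 2, so the product has mean at most [4 ^ t]; as [8 ^ t = 2 ^ t * 4 ^ t],
   a factor [2 ^ t] remains. *)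
rewrite -(leq_pmul2r (_ : 0 < 4 ^ t)%N) ?expn_gt0 // -mulnA -expnMn.
apply: leq_trans markov _; rewrite prodE card_ffun card_ord.
apply: leq_trans (_ : (2 * #|W|) ^ t.*2 <= _)%N.
  by case: (t.*2) => // m; rewrite leq_exp2r.
by rewrite expnMn -{1}mul2n expnM mulnC.
Qed.

(** * Error of the selected coordinates *)

Section Analysis.
Variables (R : realFieldType) (I : finType) (x : I -> R) (T : {set I}).
Variables (k n : nat).
Hypotheses (k_gt0 : (0 < k)%N) (n_gt0 : (0 < n)%N) (Tk : (#|T| <= k)%N).

Let tail : R := \sum_(i in ~: T) x i ^+ 2.

Lemma sum_le_card (A : {set I}) (f : I -> R) (c : R) (m : nat) :
  (#|A| <= m)%N -> 0 <= c -> (forall i, i \in A -> f i <= c) ->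
  \sum_(i in A) f i <= m%:R * c.
Proof.
move=> Am c0 fc; apply: le_trans (_ : \sum_(i in A) c <= _).
  by apply: ler_sum => i; exact: fc.
by rewrite sumr_const -[leLHS]mulr_natl ler_wpM2r // ler_nat.
Qed.

Lemma sum_sq_subset (A C : {set I}) : A \subset C ->
  \sum_(i in A) x i ^+ 2 <= \sum_(i in C) x i ^+ 2.
Proof.
move=> sAC; rewrite [leRHS](big_setID A) /= (setIidPr sAC) lerDl.
by apply: sumr_ge0 => i _; rewrite sqr_ge0.
Qed.

Lemma tail_ge0 : 0 <= tail.
Proof. by apply: sumr_ge0 => i _; rewrite sqr_ge0. Qed.

(* Every coordinate outside [L] has an estimate dominated by those of at least
   [64 k n] coordinates lying in the tail, so it is small. *)
Lemma missed_mass (e : I -> R) (L : {set I}) :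
  (forall i, (e i - x i) ^+ 2 <= tail / (128 * k%:R * n%:R)) ->
  (forall i j, i \in L -> j \notin L -> e j ^+ 2 <= e i ^+ 2) ->
  (forall j, j \notin L -> #|L| = (65 * k * n)%N) ->
  \sum_(i in T :\: L) x i ^+ 2 <= tail / (8 * n%:R).
Proof.
move=> ex Ltop Lfull; have tail0 := tail_ge0.
have K0 : 0 < k%:R :> R by rewrite ltr0n.
have N0 : 0 < n%:R :> R by rewrite ltr0n.
(* In units of [u], estimates are accurate to [u / 128], and it suffices that each of the at most
   [k] missed coordinates has square at most [u / 8]. *)
set u := tail / (k%:R * n%:R).
have u0 : 0 <= u by rewrite divr_ge0 // mulr_ge0 // ltW.
have exu i : (e i - x i) ^+ 2 <= u / 128.
  by apply: le_trans (ex i) _; rewrite /u le_eqVlt; apply/orP; left; apply/eqP;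
    field; rewrite ?gt_eqF.
have -> : tail / (8 * n%:R) = k%:R * (u / 8) by rewrite /u; field; rewrite ?gt_eqF.
apply: sum_le_card => [|| i]; [|by rewrite mulr_ge0 // invr_ge0|].
  by rewrite (leq_trans _ Tk) // subset_leq_card // subsetDl.
rewrite inE => /andP[iL iT].
set c := #|L :\: T|.
have cge : (64 * k * n <= c)%N.
  have := cardsID T L; rewrite -/c (Lfull _ iL).
  have : (#|L :&: T| <= k)%N by rewrite (leq_trans _ Tk) // subset_leq_card // subsetIr.
  have : (k <= k * n)%N by rewrite leq_pmulr.
  by rewrite -!mulnA; move: c #|_| (k * n)%N => *; lia.
(* Sum over [j] in [L :\: T] of [e i ^+ 2 <= e j ^+ 2 <= 2 * (e j - x j) ^+ 2 + 2 * x j ^+ 2]. *)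
have ci : c%:R * e i ^+ 2 <= c%:R * (u / 64) + 2 * tail.
  rewrite mulr_natl -sumr_const.
  apply: le_trans (_ : \sum_(j in L :\: T) (u / 64 + 2 * x j ^+ 2) <= _).
    apply: ler_sum => j; rewrite inE => /andP[jT jL].
    apply: le_trans (Ltop _ _ jL iL) _; have := exu j; have := sqr_ge0 (e j - 2 * x j); nra.
  rewrite big_split /= sumr_const -[_ *+ _]mulr_natl lerD2l -mulr_sumr ler_wpM2l //.
  by apply: sum_sq_subset; apply/subsetP => j; rewrite !inE => /andP[].
have cu : 64 * tail <= c%:R * u.
  apply: le_trans (_ : (64 * k * n)%:R * u <= _); last by rewrite ler_wpM2r // ler_nat.
  by rewrite /u !natrM le_eqVlt; apply/orP; left; apply/eqP; field; rewrite ?gt_eqF.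
have c0 : 0 < c%:R :> R by rewrite ltr0n (leq_trans _ cge) // !muln_gt0 k_gt0.
(* Then [x i ^+ 2] is at most [2 * (3 / 64 + 1 / 128) * u], that is [7 / 64 * u], which is below
   [u / 8]. *)
have : e i ^+ 2 <= u * (3 / 64) by rewrite -(ler_pM2l c0); lra.
by have := exu i; nra.
Qed.

(** Young's inequality for the cross term of [b + (a - b)] squared. *)
Lemma sq_le_perturbed (a b alpha : R) : 0 < alpha ->
  a ^+ 2 <= (1 + alpha) * b ^+ 2 + (1 + alpha^-1) * (a - b) ^+ 2.
Proof.
move=> al0; rewrite -subr_ge0.
have -> : (1 + alpha) * b ^+ 2 + (1 + alpha^-1) * (a - b) ^+ 2 - a ^+ 2 =
   alpha^-1 * (a - b - alpha * b) ^+ 2 by field; rewrite gt_eqF.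
by rewrite mulr_ge0 ?sqr_ge0 // invr_ge0 ltW.
Qed.

(** Exchange argument: [U] is compared with [T :&: L]. The choice of [U] orders their estimated
    masses, and [sq_le_perturbed] carries this over to the true masses at a relative cost of order
    [1 / n]. *)
Lemma selection_error (xt : I -> R) (L U : {set I}) :
  \sum_(i in T :\: L) x i ^+ 2 <= tail / (8 * n%:R) ->
  (forall i, i \in L -> (xt i - x i) ^+ 2 <= tail / (256 * k%:R * n%:R ^+ 2)) ->
  U \subset L -> (#|U| <= k)%N ->
  (forall A : {set I}, A \subset L -> (#|A| <= k)%N ->
     \sum_(i in A) xt i ^+ 2 <= \sum_(i in U) xt i ^+ 2) ->
  \sum_(i in U) (x i - xt i) ^+ 2 + \sum_(i in ~: U) x i ^+ 2
    <= (1 + n%:R^-1) * tail.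
Proof.
move=> missed xtx UL Uk Umax; have tail0 := tail_ge0.
have K0 : 0 < k%:R :> R by rewrite ltr0n.
have N0 : 0 < n%:R :> R by rewrite ltr0n.
have N1 : 1 <= n%:R :> R by rewrite ler1n.
pose al : R := (8 * n%:R)^-1.
have al0 : 0 < al by rewrite invr_gt0 mulr_gt0.
have al8 : al <= 8^-1 by rewrite lef_pV2 ?posrE ?mulr_gt0 // ler_peMr.
have -> : n%:R^-1 = 8 * al by rewrite /al; field; rewrite gt_eqF.
set a2 := tail / (256 * k%:R * n%:R ^+ 2) in xtx.
have a20 : 0 <= a2 by rewrite divr_ge0 // !mulr_ge0 // ?exprn_ge0 // ltW.
(* The total fine error is of order [al ^+ 2], so it stays of order [al] after the factor [al^-1]
   from [sq_le_perturbed]; this is why the fine accuracy needs [n ^+ 2]. *)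
have ka2 : k%:R * a2 = tail * al ^+ 2 / 4.
  by rewrite /a2 /al; field; rewrite !gt_eqF.
rewrite -[tail / _]/(tail * al) in missed.
pose T' := T :&: L.
have T'k : (#|T'| <= k)%N by rewrite (leq_trans _ Tk) // subset_leq_card // subsetIl.
set A1 := \sum_(i in T' :\: U) x i ^+ 2; set A2 := \sum_(i in U :\: T') x i ^+ 2.
have xtU (A : {set I}) : A \subset L -> (#|A| <= k)%N ->
    \sum_(i in A) (xt i - x i) ^+ 2 <= k%:R * a2.
  by move=> AL Ak; apply: sum_le_card => // i iA; apply: xtx; exact: (subsetP AL).
have sub1 : T' :\: U \subset L by rewrite subDset subsetU // subsetIr orbT.
have sub2 : U :\: T' \subset L by rewrite subDset subsetU // UL orbT.
have c1 : (#|T' :\: U| <= k)%N by rewrite (leq_trans _ T'k) // subset_leq_card // subsetDl.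
have c2 : (#|U :\: T'| <= k)%N by rewrite (leq_trans _ Uk) // subset_leq_card // subsetDl.
have hA1 : A1 <= (1 + al) * \sum_(i in T' :\: U) xt i ^+ 2 + (1 + al^-1) * (k%:R * a2).
  apply: le_trans (_ : _ <= (1 + al) * \sum_(i in T' :\: U) xt i ^+ 2 +
     (1 + al^-1) * \sum_(i in T' :\: U) (xt i - x i) ^+ 2) _.
    rewrite !mulr_sumr -big_split /=; apply: ler_sum => i _.
    by rewrite -[(xt i - x i) ^+ 2]sqrrN opprB; exact: sq_le_perturbed.
  by rewrite lerD2l ler_wpM2l ?xtU // addr_ge0 // invr_ge0 ltW.
have hA2 : \sum_(i in U :\: T') xt i ^+ 2 <= (1 + al) * A2 + (1 + al^-1) * (k%:R * a2).
  apply: le_trans (_ : _ <= (1 + al) * A2 +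
     (1 + al^-1) * \sum_(i in U :\: T') (xt i - x i) ^+ 2) _.
    rewrite !mulr_sumr -big_split /=; apply: ler_sum => i _; exact: sq_le_perturbed.
  by rewrite lerD2l ler_wpM2l ?xtU // addr_ge0 // invr_ge0 ltW.
have hmax : \sum_(i in T' :\: U) xt i ^+ 2 <= \sum_(i in U :\: T') xt i ^+ 2.
  have := Umax T' (subsetIr _ _) T'k.
  by rewrite (big_setID U) [leRHS](big_setID T') /= setIC lerD2l.
have hD : \sum_(i in U) (x i - xt i) ^+ 2 <= k%:R * a2.
  by apply: le_trans (xtU U UL Uk); apply: ler_sum => i _; rewrite -sqrrN opprB.
have splitC (A : {set I}) : \sum_(i in A) x i ^+ 2 + \sum_(i in ~: A) x i ^+ 2 = \sum_i x i ^+ 2.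
  by rewrite [RHS](bigID (mem A)) /=; congr (_ + _); apply: eq_bigl => i; rewrite !inE.
have hT' : \sum_(i in ~: T') x i ^+ 2 <= tail + tail * al.
  have := splitC T; have := splitC T'; rewrite -/tail => <-.
  rewrite (big_setID L) /= -/T' -addrA => /addrI; rewrite addrC => <-.
  by rewrite lerD2l.
(* Passing from [T'] to [U] loses [A1] and gains [A2]. *)
have hU : \sum_(i in ~: U) x i ^+ 2 = \sum_(i in ~: T') x i ^+ 2 + A1 - A2.
  have := splitC U; have := splitC T'; rewrite (big_setID U) [in X in _ -> X](big_setID T') /=.
  by rewrite setIC -/A1 -/A2 => <- ; move=> ?; lra.
have hA2T : A2 <= \sum_(i in ~: T') x i ^+ 2.
  by apply: sum_sq_subset; apply/subsetP => i; rewrite !inE => /andP[].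
have A20 : 0 <= A2 by apply: sumr_ge0 => i _; rewrite sqr_ge0.
rewrite ka2 in hA1 hA2 hD; rewrite hU.
have inv : (1 + al^-1) * (tail * al ^+ 2 / 4) = tail * al * (1 + al) / 4.
  by field; rewrite gt_eqF.
rewrite inv in hA1 hA2.
set E' := \sum_(i in ~: T') _ in hT' hA2T hU *.
set s1 := \sum_(i in T' :\: U) _ in hA1 hmax; set s2 := \sum_(i in U :\: T') _ in hA2 hmax.
set D := \sum_(i in U) _ in hD *.
have h1 : A1 <= (1 + al) * ((1 + al) * A2 + tail * al * (1 + al) / 4) + tail * al * (1 + al) / 4.
  apply: le_trans hA1 _; rewrite lerD2r ler_wpM2l //; first by lra.
  exact: le_trans hmax hA2.
(* As [al <= 1 / 8], higher powers of [al] become multiples of [tail * al]; all losses together stay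
   below the allowed [8 * al * tail]. *)
have ta : tail * al ^+ 2 <= tail * al / 8.
  by rewrite expr2 mulrA ler_wpM2l // mulr_ge0 // ltW.
have ta3 : tail * al ^+ 3 <= tail * al / 64.
  have -> : tail * al ^+ 3 = tail * al ^+ 2 * al by ring.
  nra.
have A2a : A2 * al <= (tail + tail * al) * al by
  rewrite ler_wpM2r ?(ltW al0) //; apply: le_trans hA2T hT'.
have A2aa : A2 * al ^+ 2 <= (tail + tail * al) * al ^+ 2.
  by rewrite ler_wpM2r ?exprn_ge0 ?(ltW al0) //; apply: le_trans hA2T hT'.
have tal : 0 <= tail * al by rewrite mulr_ge0 // ltW.
nra.
Qed.

End Analysis.

(** * The two-stage sketch *)

From mathcomp Require Import all_classical all_reals all_analysis.

(** Union bound giving failure probability [#|I| / q1 + K / q2], with denominators cleared. Once the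
    first seed is fixed, [L] is a fixed set, so the second stage pays for [K] coordinates only. *)
Lemma card_two_stage_failure (W1 W2 I : finType) (P1 : I -> {set W1})
    (P2 : I -> {set W2}) (L : W1 -> {set I}) (q1 q2 K : nat)
    (F : {set (W1 * W2)%type}) :
  (forall i, #|P1 i| * q1 <= #|W1|)%N -> (forall i, #|P2 i| * q2 <= #|W2|)%N ->
  (forall w, #|L w| <= K)%N ->
  (forall w, w \in F -> (exists i, w.1 \in P1 i) \/
     (exists2 i, i \in L w.1 & w.2 \in P2 i)) ->
  (#|F| * (q1 * q2) <= (#|I| * q2 + K * q1) * (#|W1| * #|W2|))%N.
Proof.
move=> P1q P2q LK Fsub.
have indE (T : finType) (A : {set T}) : (\sum_(w : T) (w \in A))%N = #|A|.
  by rewrite -sum1_card [RHS]big_mkcond.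
have cF : (#|F| <= \sum_(w1 : W1) \sum_(w2 : W2)
    (\sum_(i : I) (w1 \in P1 i) + \sum_(i in L w1) (w2 \in P2 i)))%N.
  rewrite -sum1_card big_mkcond /= pair_big /=; apply: leq_sum => w _.
  case: ifP => // /Fsub [[i wi]|[i iL wi]].
    by rewrite (bigD1 i) //= wi.
  by rewrite addnC (bigD1 i) //= wi.
have c1 : ((\sum_(w1 : W1) \sum_(w2 : W2) \sum_(i : I) (w1 \in P1 i)) * q1 <=
    #|I| * #|W1| * #|W2|)%N.
  have -> : (\sum_(w1 : W1) \sum_(w2 : W2) \sum_(i : I) (w1 \in P1 i) =
      \sum_(i : I) #|P1 i| * #|W2|)%N.
    under eq_bigr => w1 _ do rewrite sum_nat_const.
    rewrite -big_distrr exchange_big /= mulnC big_distrl /=.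
    by apply: eq_bigr => i _; rewrite indE.
  rewrite big_distrl /= -mulnA -sum_nat_const; apply: leq_sum => i _.
  by rewrite mulnAC leq_mul2r P1q orbT.
have c2 : ((\sum_(w1 : W1) \sum_(w2 : W2) \sum_(i in L w1) (w2 \in P2 i)) * q2 <=
    K * #|W1| * #|W2|)%N.
  rewrite [(K * _)%N]mulnC -mulnA -sum_nat_const big_distrl /=; apply: leq_sum => w1 _.
  rewrite exchange_big /= big_distrl /=.
  apply: leq_trans (_ : \sum_(i in L w1) #|W2| <= _)%N.
    by apply: leq_sum => i _; rewrite indE P2q.
  by rewrite sum_nat_const leq_mul2r LK orbT.
apply: leq_trans (_ : _ <= (\sum_(w1 : W1) \sum_(w2 : W2) \sum_(i : I) (w1 \in P1 i)
    + \sum_(w1 : W1) \sum_(w2 : W2) \sum_(i in L w1) (w2 \in P2 i)) * (q1 * q2))%N _.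
  rewrite leq_mul2r; apply/orP; right; apply: leq_trans cF _.
  rewrite -big_split /= leq_eqVlt; apply/orP; left; apply/eqP.
  by apply: eq_bigr => w1 _; rewrite -big_split.
rewrite !mulnDl leq_add //.
  by rewrite mulnA -[leqRHS]mulnA [(q2 * _)%N]mulnC mulnA leq_mul2r mulnA c1 orbT.
rewrite [(q1 * _)%N]mulnC mulnA -[leqRHS]mulnA [(q1 * _)%N]mulnC mulnA leq_mul2r.
by rewrite mulnA c2 orbT.
Qed.

Section Recovery.
Variable R : realType.

(** This selection and the next two are fixed functions obtained by choice; ties are broken
    arbitrarily. *)
Definition top_set (I : finType) (f : I -> R) (K : nat) : {set I} :=
  sval (cid (top_set_exists f K)).

Definition max_sum_subset (I : finType) (f : I -> R) (L : {set I}) (k : nat) : {set I} :=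
  sval (cid (max_sum_subset_exists f L k)).

Definition median (t : nat) (e : 'I_(t.*2) -> R) : R :=
  sval (cid (median_exists e)).

Definition candidates (d t K : nat) (f : 'I_(t.*2) -> 'I_d -> R) : {set 'I_d} :=
  top_set (fun i => median (f ^~ i) ^+ 2) K.

Definition recover_from (d t1 t2 K k : nat) (f1 : 'I_(t1.*2) -> 'I_d -> R)
    (f2 : 'I_(t2.*2) -> 'I_d -> R) : 'cV[R]_d :=
  let xt i := median (f2 ^~ i) in
  let U := max_sum_subset (fun i => xt i ^+ 2) (candidates K f1) k in
  \col_i (if i \in U then xt i else 0).

(** The deterministic half of the argument: [median_near] turns a minority of bad repetitions into
    accurate medians, which feed [missed_mass] and then [selection_error]. *)
Lemma recover_from_correct (d t1 t2 k n : nat) (f1 : 'I_(t1.*2) -> 'I_d -> R)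
    (f2 : 'I_(t2.*2) -> 'I_d -> R) (x : 'cV[R]_d) (T : {set 'I_d}) (b1 b2 : R) :
  let tail := \sum_(i in ~: T) x i 0 ^+ 2 in
  let K := (65 * k * n)%N in
  (0 < k)%N -> (0 < n)%N -> (#|T| <= k)%N ->
  b1 <= tail / (128 * k%:R * n%:R) -> b2 <= tail / (256 * k%:R * n%:R ^+ 2) ->
  (forall i, #|[set r | (b1 < (f1 r i - x i 0) ^+ 2)%R]| < t1)%N ->
  (forall i, i \in candidates K f1 ->
     #|[set r | (b2 < (f2 r i - x i 0) ^+ 2)%R]| < t2)%N ->
  Psi R d k (recover_from K k f1 f2) /\
  l2norm (x - recover_from K k f1 f2) ^+ 2 <= (1 + n%:R^-1) * tail.
Proof.
move=> tail K k0 n0 Tk hb1 hb2 few1 few2.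
rewrite /recover_from /max_sum_subset; case: cid => U [/= UL Uk Umax].
set xt := fun i => median (f2 ^~ i).
have ex i : (median (f1 ^~ i) - x i 0) ^+ 2 <= tail / (128 * k%:R * n%:R).
  apply: le_trans hb1; rewrite /median; case: cid => v /= vm.
  by apply: median_near vm (few1 i).
have xtx i : i \in candidates K f1 -> (xt i - x i 0) ^+ 2 <= tail / (256 * k%:R * n%:R ^+ 2).
  move=> iL; apply: le_trans hb2; rewrite /xt /median; case: cid => v /= vm.
  by apply: median_near vm (few2 i iL).
have missed : \sum_(i in T :\: candidates K f1) x i 0 ^+ 2 <= tail / (8 * n%:R).
  rewrite /candidates /top_set; case: cid => L [/= LK [Ltop Lfull]].
  exact: (@missed_mass R 'I_d (x ^~ 0) T k n k0 n0 Tk _ L ex Ltop Lfull).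
have := @selection_error R 'I_d (x ^~ 0) T k n k0 n0 Tk xt _ U missed xtx UL Uk Umax.
move=> err; split.
  rewrite /Psi /= /l0norm; apply: leq_trans Uk; apply/subset_leq_card/fintype.subsetP => i.
  by rewrite !inE mxE; case: ifP => //; rewrite eqxx.
apply: le_trans err; rewrite l2norm_sq (bigID (mem U)) /= lerD //.
  by apply: ler_sum => i iU; rewrite !mxE iU.
rewrite le_eqVlt; apply/orP; left; apply/eqP; apply: eq_big => i; first by rewrite !finset.inE.
by move=> /negPf iU; rewrite !mxE iU subr0.
Qed.

Section Sketch.
Variables d t1 t2 B1 B2 : nat.

Definition row_index : Type :=
  (('I_(t1.*2) * 'I_B1.+1) + ('I_(t2.*2) * 'I_B2.+1))%type.
HB.instance Definition _ := Finite.on row_index.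

Definition seeds : Type :=
  ({ffun 'I_(t1.*2) -> {ffun 'I_d -> 'I_B1.+1 * bool}} *
   {ffun 'I_(t2.*2) -> {ffun 'I_d -> 'I_B2.+1 * bool}})%type.
HB.instance Definition _ := Finite.on seeds.

Lemma card_row_index : #|{: row_index}| = (t1.*2 * B1.+1 + t2.*2 * B2.+1)%N.
Proof. by rewrite card_sum !card_prod !card_ord. Qed.

Definition sketch (w : seeds) : 'M[R]_(#|{: row_index}|, d) :=
  \matrix_(a, j) match (enum_val a : row_index) with
    | inl p => hash_entry R (w.1 p.1) p.2 j
    | inr p => hash_entry R (w.2 p.1) p.2 j
    end.

(** Computed from the entries of [S] and the measurements alone, as a recovery procedure must be. *)
Definition coarse_estimates (S : 'M[R]_(#|{: row_index}|, d)) (y : 'cV[R]_#|{: row_index}|)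
    (r : 'I_(t1.*2)) (i : 'I_d) : R :=
  let row b := enum_rank (inl (r, b) : row_index) in
  backproject (fun b j => S (row b) j) (fun b => y (row b) 0) i.

Definition fine_estimates (S : 'M[R]_(#|{: row_index}|, d)) (y : 'cV[R]_#|{: row_index}|)
    (r : 'I_(t2.*2)) (i : 'I_d) : R :=
  let row b := enum_rank (inr (r, b) : row_index) in
  backproject (fun b j => S (row b) j) (fun b => y (row b) 0) i.

Definition two_stage_recovery (K k : nat) : recovery R #|{: row_index}| d :=
  fun S y => recover_from K k (coarse_estimates S y) (fine_estimates S y).

Lemma coarse_estimates_sketch (w : seeds) (x : 'cV[R]_d) :
  coarse_estimates (sketch w) (sketch w *m x) = fun r i => estimate (x ^~ 0) (w.1 r) i.
Proof.
apply/funext => r; apply/funext => i; rewrite /coarse_estimates /estimate /backproject.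
apply: eq_bigr => b _; rewrite !mxE enum_rankK /=; congr (_ * _).
by apply: eq_bigr => j _; rewrite !mxE enum_rankK.
Qed.

Lemma fine_estimates_sketch (w : seeds) (x : 'cV[R]_d) :
  fine_estimates (sketch w) (sketch w *m x) = fun r i => estimate (x ^~ 0) (w.2 r) i.
Proof.
apply/funext => r; apply/funext => i; rewrite /fine_estimates /estimate /backproject.
apply: eq_bigr => b _; rewrite !mxE enum_rankK /=; congr (_ * _).
by apply: eq_bigr => j _; rewrite !mxE enum_rankK.
Qed.

(** [2048 = 16 * 128] and [4096 = 16 * 256] bring the CountSketch error [16 / B.+1] down to the
    accuracies asked by [recover_from_correct]; [card_two_stage_failure] then counts the seeds whose
    medians may fail. *)
Lemma card_recovery_failure (k n : nat) (eps : R) (x : 'cV[R]_d) (F : {set seeds}) :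
  (0 < k)%N -> (0 < n)%N -> n%:R^-1 <= eps ->
  (2048 * k * n <= B1.+1)%N -> (4096 * k * n ^ 2 <= B2.+1)%N ->
  (forall w, w \in F ->
     ~ recovers k eps (two_stage_recovery (65 * k * n) k) (sketch w) x) ->
  (#|F| * (2 ^ t1 * 2 ^ t2) <= (d * 2 ^ t2 + 65 * k * n * 2 ^ t1) * #|{: seeds}|)%N.
Proof.
move=> k0 n0 neps hB1 hB2 Ffail.
have [y yk [yE _]] := best_sq_err_attained k x.
(* [T] is the support of a best approximation [y]; off [T] the residual is [x] itself, so the tail
   is at most the best error. *)
pose T : {set 'I_d} := finset (fun i => y i 0 != 0).
have Tk : (#|T| <= k)%N.
  by apply: leq_trans yk; apply/subset_leq_card/fintype.subsetP => i; rewrite !finset.inE.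
pose tail := \sum_(i in ~: T) x i 0 ^+ 2.
have tail0 : 0 <= tail by apply: sumr_ge0 => i _; rewrite sqr_ge0.
have tailE : tail <= best_sq_err k x.
  rewrite yE l2norm_sq [leRHS](bigID (mem (~: T))) /= /tail.
  rewrite -[leLHS]addr0 lerD //; last by apply: sumr_ge0 => i _; rewrite sqr_ge0.
  apply: ler_sum => i; rewrite !finset.inE negbK => /eqP yi.
  by rewrite !mxE yi subr0.
pose far B i : {set {ffun 'I_d -> 'I_B.+1 * bool}} :=
  finset (fun w => 16 / B.+1%:R * tail < (estimate (x ^~ 0) w i - x i 0) ^+ 2).
pose P B t i : {set {ffun 'I_(t.*2) -> {ffun 'I_d -> 'I_B.+1 * bool}}} :=
  finset (fun o : {ffun 'I_(t.*2) -> {ffun 'I_d -> 'I_B.+1 * bool}} =>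
    (t <= #|finset (fun r => o r \in far B i)|)%N).
have Pq B t i : (16 * k <= B.+1)%N ->
    (#|P B t i| * 2 ^ t <= #|{ffun 'I_(t.*2) -> {ffun 'I_d -> 'I_B.+1 * bool}}|)%N.
  move=> kB; apply: card_majority_bad; apply: card_estimate_far.
  by apply: leq_trans kB; rewrite leq_mul2l Tk orbT.
have kB1 : (16 * k <= B1.+1)%N by apply: leq_trans hB1; nia.
have kB2 : (16 * k <= B2.+1)%N by apply: leq_trans hB2; rewrite expnS expn1; nia.
have K0 : 0 < k%:R :> R by rewrite ltr0n.
have N0 : 0 < n%:R :> R by rewrite ltr0n.
have thr B c : 0 < c -> c <= B.+1%:R -> 16 / B.+1%:R * tail <= tail * 16 / c.
  move=> c0 cB; rewrite mulrC mulrA ler_wpM2l ?mulr_ge0 //.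
  by rewrite lef_pV2 // posrE // ltr0n.
have := @card_two_stage_failure _ _ _ (P B1 t1) (P B2 t2)
  (fun o => candidates (65 * k * n) (fun r i => estimate (x ^~ 0) (o r) i))
  (2 ^ t1) (2 ^ t2) (65 * k * n) F.
rewrite card_ord [#|{: seeds}|]card_prod; apply => [i|i|o|w wF].
- exact: Pq.
- exact: Pq.
- by rewrite /candidates /top_set; case: cid => L [].
have [/existsP[i]|none1] := boolP [exists i, w.1 \in P B1 t1 i]; first by left; exists i.
(* If neither stage has a bad coordinate, the recovery succeeds, contradicting the choice of [F]. *)
right; apply: contrapT => none2; apply: (Ffail w wF).
rewrite /recovers /two_stage_recovery coarse_estimates_sketch fine_estimates_sketch.
set f1 := (f in recover_from _ _ f _); set f2 := (f in recover_from _ _ _ f).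
have [] := @recover_from_correct d t1 t2 k n f1 f2 x T
  (16 / B1.+1%:R * tail) (16 / B2.+1%:R * tail) k0 n0 Tk.
- have c0 : 0 < 2048 * k%:R * n%:R :> R.
    by apply: mulr_gt0 N0; apply: mulr_gt0 K0; rewrite ltr0n.
  have cB : 2048 * k%:R * n%:R <= B1.+1%:R :> R by rewrite -!natrM ler_nat.
  apply: le_trans (thr B1 _ c0 cB) _.
  have -> : tail * 16 / (2048 * k%:R * n%:R) = tail / (128 * k%:R * n%:R).
    by field; rewrite !gt_eqF.
  exact: lexx.
- have c0 : 0 < 4096 * k%:R * n%:R ^+ 2 :> R.
    apply: mulr_gt0 (exprn_gt0 _ N0); apply: mulr_gt0 K0; rewrite ltr0n; exact: isT.
  have cB : 4096 * k%:R * n%:R ^+ 2 <= B2.+1%:R :> R.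
    by rewrite -natrX -!natrM ler_nat.
  apply: le_trans (thr B2 _ c0 cB) _.
  have -> : tail * 16 / (4096 * k%:R * n%:R ^+ 2) = tail / (256 * k%:R * n%:R ^+ 2).
    by field; rewrite !gt_eqF.
  exact: lexx.
- move=> i; rewrite ltnNge; apply: contra none1 => ti; apply/existsP; exists i.
  rewrite finset.inE; apply: leq_trans ti _; apply/subset_leq_card/fintype.subsetP => r.
  by rewrite !finset.inE.
- move=> i iL; rewrite ltnNge; apply/negP => ti; apply: none2; exists i => //.
  rewrite finset.inE; apply: leq_trans ti _; apply/subset_leq_card/fintype.subsetP => r.
  by rewrite !finset.inE.
move=> hPsi err; split=> //; apply: le_trans err _.
apply: le_trans (_ : (1 + eps) * tail <= _); first by rewrite ler_wpM2r // lerD2l.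
rewrite ler_wpM2l // addr_ge0 // (le_trans _ neps) // invr_ge0 ltW //.
Qed.

End Sketch.
End Recovery.

(** Normalized counting measure on the first [#|F|] integers, with [f] enumerating [F]. Every subset
    of [nat] is measurable, so no measurability question arises for the sketch or the success
    event. *)
Lemma uniform_probability_exists (R : realType) (F : finType) (w0 : F) :
  exists (P : probability nat R) (f : nat -> F),
    forall A : {set F}, P [set w | f w \in A]%classic = (#|A|%:R / #|F|%:R)%:E.
Proof.
pose mu : {measure set nat -> \bar R} := msum (fun k : nat => \d_k) #|F|.
pose f (k : nat) := nth w0 (enum F) k.
have muE (A : {set F}) : mu [set w | f w \in A]%classic = #|A|%:R%:E.
  have -> : #|A|%:R = \sum_(i : F) (i \in A)%:R :> R.
    by rewrite -natr_sum -sum1_card big_mkcond.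
  rewrite (reindex (@enum_val F predT)) /=; last first.
    by apply: onW_bij; exact: enum_val_bij.
  rewrite -sumEFin /mu /= /msum /=; apply: eq_bigr => k _.
  rewrite diracE /f (enum_val_nth w0); case: (boolP (_ \in A)) => kA.
    by rewrite mem_set.
  by rewrite memNset //=; exact/negP.
have mu1 : mu [set: nat]%classic = #|F|%:R%:E.
  by rewrite -cardsT -muE; congr (mu _); apply/seteqP; split=> w //= _; rewrite finset.inE.
have F0 : (0 < #|F|%:R :> R) by rewrite ltr0n; apply/card_gt0P; exists w0.
exists (mnormalize mu \d_0%N), f => A.
rewrite /= /mnormalize mu1 eqe gt_eqF //= /fine muE.
by rewrite -EFinM.
Qed.

(** * Number of rows and failure probability *)

Lemma ln2_ge_half (R : realType) : 1 / 2 <= ln 2 :> R.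
Proof.
have : ln (1 + - (1 / 2)) <= - (1 / 2) :> R by apply: le_ln1Dx; lra.
have -> : 1 + - (1 / 2) = 2^-1 :> R by lra.
by rewrite lnV ?posrE // => ?; lra.
Qed.

(** From [2 ^ u.-1 < q] and [ln 2 >= 1 / 2] follows [u <= 2 * ln q + 1], and [1 <= 2 * ln q] absorbs
    the rounding. *)
Lemma up_log2_le_ln (R : realType) (q : nat) : (1 < q)%N ->
  (up_log 2 q)%:R <= 4 * ln q%:R :> R.
Proof.
move=> q1; set u := up_log 2 q.
have /andP[lo _] : (2 ^ u.-1 < q <= 2 ^ u)%N by exact: up_log_bounds.
have u0 : (0 < u)%N by rewrite up_log_gt0.
have h2 := ln2_ge_half R.
have lnq : ln 2 <= ln q%:R :> R by rewrite ler_ln ?posrE ?ltr0n ?ler_nat // ltnW.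
have : u.-1%:R * ln 2 <= ln q%:R :> R.
  rewrite mulr_natl -lnXn // ler_ln ?posrE ?exprn_gt0 ?ltr0n 1?ltnW //.
  by rewrite -natrX ler_nat ltnW.
have -> : u.-1%:R = u%:R - 1 :> R by rewrite -subn1 natrB.
have : 1 <= u%:R :> R by rewrite ler1n.
nra.
Qed.

(** The coarse rows are charged to [Y]. For the fine rows, [k * n <= 2 * k / eps] turns the
    logarithm into [ln 2 + ln (k / eps)], and the spare [ln 2] must be absorbed too. *)
Lemma measurements_bound (R : realType) (c1 c2 d k n B1 B2 : nat) (eps a b : R) :
  (1 < d)%N -> (0 < k)%N -> 0 < eps -> eps < 1 -> n%:R <= 2 / eps ->
  (1 < k * n)%N -> 0 <= a -> 0 <= b ->
  B1.+1%:R <= a * (k%:R * n%:R) -> B2.+1%:R <= b * (k%:R * n%:R ^+ 2) ->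
  ((c1 * up_log 2 d).*2 * B1.+1 + (c2 * up_log 2 (k * n)).*2 * B2.+1)%:R <=
  (16 * a * c1%:R + 64 * b * c2%:R) *
    (k%:R * ln (k%:R / eps) / eps ^+ 2 + k%:R * ln d%:R / eps).
Proof.
move=> d1 k0 eps0 eps1 nle kn1 a0 b0 hB1 hB2.
have K1 : 1 <= k%:R :> R by rewrite ler1n.
have keps : 1 < k%:R / eps by rewrite ltr_pdivlMr // mul1r (lt_le_trans eps1).
have keps0 : 0 < k%:R / eps by exact: lt_trans keps.
have lnk : 0 <= ln (k%:R / eps) by rewrite ln_ge0 // ltW.
have lnd : 0 <= ln d%:R :> R by rewrite ln_ge0 // ler1n ltnW.
set X := k%:R * ln (k%:R / eps) / eps ^+ 2; set Y := k%:R * ln d%:R / eps.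
have ie0 : 0 <= eps^-1 by rewrite invr_ge0 ltW.
have ie20 : 0 <= (eps ^+ 2)^-1 by rewrite invr_ge0 exprn_ge0 // ltW.
have X0 : 0 <= X by rewrite /X !mulr_ge0.
have Y0 : 0 <= Y by rewrite /Y !mulr_ge0.
have ud := up_log2_le_ln R d1; have ukn := up_log2_le_ln R kn1.
have h2 := ln2_ge_half R.
have ln2d : ln 2 <= ln d%:R :> R by rewrite ler_ln ?posrE ?ltr0n ?ler_nat // ltnW.
have lnkn : ln (k * n)%:R <= ln 2 + ln (k%:R / eps) :> R.
  rewrite -lnM ?posrE // ler_ln ?posrE ?ltr0n ?(ltnW kn1) //; last exact: mulr_gt0.
  by rewrite natrM [2 * _]mulrCA ler_wpM2l.
(* [ln (k / eps)] may be close to 0. It absorbs [ln 2] when [eps < 1 / 2]; otherwise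
   [1 / eps ^+ 2 <= 2 / eps] and [ln 2 <= ln d] let [2 * Y] do so. *)
have ln2X : k%:R * ln 2 / eps ^+ 2 <= X + 2 * Y.
  have [e2|e2] := ltrP eps (1 / 2).
    apply: le_trans (_ : X <= _); last by rewrite lerDl mulr_ge0.
    rewrite /X ler_wpM2r // ler_wpM2l //.
    rewrite ler_ln ?posrE // ler_pdivlMr //.
    lra.
  apply: le_trans (_ : 2 * Y <= _); last by rewrite lerDr.
  have -> : 2 * Y = k%:R * (ln d%:R * (2 * eps)) / eps ^+ 2.
    by rewrite /Y; field; rewrite gt_eqF.
  by rewrite ler_wpM2r // ler_wpM2l //; nra.
have h1 : ((c1 * up_log 2 d).*2 * B1.+1)%:R <= 16 * a * c1%:R * Y.
  rewrite -mul2n !natrM.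
  apply: le_trans (_ : 2 * (c1%:R * (4 * ln d%:R)) * (a * (k%:R * (2 / eps))) <= _).
    apply: ler_pM; rewrite ?mulr_ge0 //.
      by rewrite ler_wpM2l // ler_wpM2l.
    by apply: le_trans hB1 _; rewrite ler_wpM2l // ler_wpM2l.
  by rewrite /Y le_eqVlt; apply/orP; left; apply/eqP; field; rewrite gt_eqF.
have h3 : ((c2 * up_log 2 (k * n)).*2 * B2.+1)%:R <=
    32 * b * c2%:R * (2 * X + 2 * Y).
  rewrite -mul2n !natrM.
  apply: le_trans (_ : 2 * (c2%:R * (4 * (ln 2 + ln (k%:R / eps)))) *
                       (b * (k%:R * (2 / eps) ^+ 2)) <= _).
    apply: ler_pM; rewrite ?mulr_ge0 //.
      rewrite ler_wpM2l // ler_wpM2l //; exact: le_trans ukn (ler_wpM2l (ler0n R 4) lnkn).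
    apply: le_trans hB2 _; rewrite ler_wpM2l // ler_wpM2l //.
    by rewrite lerXn2r ?nnegrE ?mulr_ge0.
  have -> : 2 * (c2%:R * (4 * (ln 2 + ln (k%:R / eps)))) *
      (b * (k%:R * (2 / eps) ^+ 2)) =
      32 * b * c2%:R * (k%:R * ln 2 / eps ^+ 2 + X).
    by rewrite /X; field; rewrite gt_eqF.
  by rewrite ler_wpM2l ?mulr_ge0 //; lra.
rewrite natrD; apply: le_trans (lerD h1 h3) _.
have p1 : 0 <= a * c1%:R * X by rewrite !mulr_ge0.
have -> : 32 * b * c2%:R * (2 * X + 2 * Y) = 64 * b * c2%:R * (X + Y) by ring.
rewrite [leRHS]mulrDl lerD2r ler_wpM2l ?mulr_ge0 // lerDr //.
Qed.

Local Open Scope classical_set_scope.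

(** The exponents of the two inverse polynomials are arbitrary and fixed in advance; [C] depends on
    them but not on [d], [k] or [eps]. *)
Theorem theorem11 (R : realType) (c1 c2 : nat) :
  exists2 C : R, 0 < C &
  forall (d k : nat) (eps : R), (1 <= k)%N -> (k <= d)%N -> 0 < eps -> eps < 1 ->
  exists (m : nat) (disp : measure_display) (Omega : measurableType disp)
         (P : probability Omega R) (S : Omega -> 'M[R]_(m, d))
         (rec : recovery R m d),
    [/\ m%:R <= C * (k%:R * ln (k%:R / eps) / eps ^+ 2 + k%:R * ln d%:R / eps),
        random_matrix S &
        forall x : 'cV[R]_d,
          let good := [set w : Omega | recovers k eps rec (S w) x] in
          measurable good /\
          ((1 - (d%:R ^+ c1)^-1 - ((k%:R / eps) ^+ c2)^-1)%:E <= P good)%E].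
Proof.
(* Bucket counts are successors: at most [2048 + 1] times [k * n] and [4096 + 1] times
   [k * n ^ 2]. *)
have [a a0 aE] : exists2 a : R, 0 < a & a = 2049%:R by exists 2049%:R; rewrite ?ltr0n.
have [b b0 bE] : exists2 b : R, 0 < b & b = 4097%:R by exists 4097%:R; rewrite ?ltr0n.
exists (16 * a * c1.+1%:R + 64 * b * (c2 + 8)%:R).
  by rewrite addr_gt0 // !mulr_gt0 // ltr0n // addnS.
move=> d k eps k1 kd eps0 eps1.
have K1 : 1 <= k%:R :> R by rewrite ler1n.
have keps : 1 < k%:R / eps by rewrite ltr_pdivlMr // mul1r (lt_le_trans eps1).
have keps0 : 0 < k%:R / eps by exact: lt_trans keps.
(* For d = 1 the required success probability is at most 0. *)
have [d1|d1] := leqP d 1.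
  have dE : d = 1%N by apply/eqP; rewrite eqn_leq d1 (leq_trans k1).
  exists 0%N, _, nat, \d_0%N, (fun _ => 0), (fun _ _ => 0); split.
  - rewrite mulr_ge0 ?addr_ge0 ?mulr_ge0 ?ln_ge0 ?invr_ge0 ?exprn_ge0 //;
      by rewrite ?(ltW a0) ?(ltW b0) ?(ltW keps) ?(ltW eps0) ?dE.
  - by move=> [].
  - move=> x good; split=> //; apply: (@le_trans _ _ 0%E) => //.
    rewrite dE expr1n invr1 lee_fin subrr sub0r oppr_le0 invr_ge0 exprn_ge0 //.
    exact: ltW.
(* The added 1 is absorbed by [1 < 1 / eps] in the bound [2 / eps]. *)
pose n := (Num.truncn eps^-1).+1.
have n0 : (0 < n)%N by [].
have nge : eps^-1 < n%:R by exact: truncnS_gt.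
have nle : n%:R <= 2 / eps.
  have : (Num.truncn eps^-1)%:R <= eps^-1 by rewrite truncn_le // invr_ge0 ltW.
  have : 1 < eps^-1 by rewrite invf_gt1.
  rewrite /n -natr1; lra.
move: n n0 nge nle => n n0 nge nle.
have N0 : 0 < n%:R :> R by rewrite ltr0n.
have neps : n%:R^-1 <= eps by rewrite -[leRHS]invrK lef_pV2 ?posrE ?invr_gt0 // ltW.
have keps_kn : k%:R / eps <= (k * n)%:R.
  by rewrite natrM ler_wpM2l // ltW.
have kn1 : (1 < k * n)%N by rewrite -(ltr_nat R) (lt_le_trans keps).
have buckets c q : (0 < q)%N -> exists2 B, (c * q <= B.+1)%N & (B.+1 <= c.+1 * q)%N.
  by move=> q0; exists (c * q)%N; rewrite ?leqnSn // mulSn -addn1 addnC leq_add2r.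
have [B1 B1lo B1hi] := buckets 2048%N (k * n)%N (ltnW kn1).
have [|B2 B2lo B2hi] := buckets 4096%N (k * n ^ 2)%N; first by rewrite muln_gt0 k1 expn_gt0 n0.
rewrite mulnA in B1lo; rewrite mulnA in B2lo.
have {}B1hi : B1.+1%:R <= a * (k%:R * n%:R) by rewrite aE -2!natrM ler_nat.
have {}B2hi : B2.+1%:R <= b * (k%:R * n%:R ^+ 2).
  by rewrite bE -natrX -2!natrM ler_nat.
have rows := @measurements_bound R c1.+1 (c2 + 8) d k n B1 B2 eps a b d1 k1 eps0
  eps1 nle kn1 (ltW a0) (ltW b0) B1hi B2hi.
(* [2 ^ t1 >= d ^ c1.+1], where one power of [d] pays for the union over [d] coordinates. Likewise
   [2 ^ t2 >= (k * n) ^ (c2 + 8)], where eight powers pay for [65 * k * n], as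
   [65 <= 2 ^ 7 <= (k * n) ^ 7]. *)
set t1 := (c1.+1 * up_log 2 d)%N in rows; set t2 := ((c2 + 8) * _)%N in rows.
pose W := seeds d t1 t2 B1 B2.
have w0 : W by exact: ([ffun=> [ffun=> (ord0, true)]], [ffun=> [ffun=> (ord0, true)]]).
have [P [f Pf]] := @uniform_probability_exists R W w0.
pose rec := @two_stage_recovery R d t1 t2 B1 B2 (65 * k * n) k.
exists #|{: row_index t1 t2 B1 B2}|, _, nat, P, (fun w => sketch R (f w)), rec.
split; [by rewrite card_row_index | by move=> i j; [] |].
move=> x good; split=> //.
pose good_seeds : {set W} := finset (fun w => `[< recovers k eps rec (sketch R w) x >]).
have -> : good = [set w | f w \in good_seeds].
  by apply/seteqP; split=> w /=; rewrite finset.inE asboolE.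
rewrite Pf lee_fin.
have failP w : w \in ~: good_seeds -> ~ recovers k eps rec (sketch R w) x.
  by rewrite !finset.inE => /asboolPn.
have fail := card_recovery_failure k1 n0 neps B1lo B2lo failP.
have cW : (0 < #|{: W}|%:R :> R) by rewrite ltr0n; apply/card_gt0P; exists w0.
have -> : #|good_seeds|%:R = #|{: W}|%:R - #|~: good_seeds|%:R :> R.
  by rewrite -(cardsC good_seeds) natrD addrK.
rewrite mulrBl divff ?gt_eqF // -addrA -opprD lerD2l lerN2.
have p0 m : 0 < 2 ^+ m :> R by rewrite exprn_gt0.
apply: le_trans (_ : d%:R / 2 ^+ t1 + (65 * k * n)%:R / 2 ^+ t2 <= _).
  rewrite ler_pdivrMr //; move: fail; rewrite -(ler_nat R).
  rewrite [(_ + _)%N]lock !natrM -lock natrD !natrM !natrX => fail.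
  rewrite -(ler_pM2r (mulr_gt0 (p0 t1) (p0 t2))); apply: le_trans fail _.
  by rewrite le_eqVlt; apply/orP; left; apply/eqP; field; rewrite !gt_eqF.
apply: lerD.
- rewrite ler_pdivrMr // mulrC ler_pdivlMr ?exprn_gt0 ?ltr0n ?(ltnW d1) //.
  rewrite -exprS -!natrX ler_nat /t1 mulnC expnM.
  by rewrite leq_exp2r //; exact: up_logP.
- rewrite ler_pdivrMr // mulrC ler_pdivlMr ?exprn_gt0 //.
  (* The real base [k / eps] is replaced by the larger integer [k * n]. *)
  apply: le_trans (_ : (65 * k * n)%:R * (k * n)%:R ^+ c2 <= _).
    by rewrite ler_wpM2l // lerXn2r // nnegrE // ltW.
  rewrite -!natrX -natrM ler_nat /t2 [in leqRHS]mulnC expnM.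
  apply: leq_trans (_ : (k * n) ^ (c2 + 8) <= _)%N; last first.
    by rewrite leq_exp2r ?addnS //; exact: up_logP.
  rewrite -[(65 * k * n)%N]mulnA; move: (k * n)%N kn1 => q q1.
  rewrite expnD [(q ^ 8)%N]expnS mulnC leq_mul2l; apply/orP; right.
  rewrite mulnC leq_mul2l; apply/orP; right.
  by apply: leq_trans (_ : 2 ^ 7 <= _)%N => //; rewrite leq_exp2r.
Qed.
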